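(* Let $K$ be a field of characteristic $\neq 2,3$. Then every commutative (not necessarily associative) $K$-algebra satisfying the identity $L_x^3=\frac12 L_{x^3}$ is locally nilpotent. More precisely, for every $k\ge 1$, every commutative $K$-algebra generated by $k$ elements and satisfying the identity $L_x^3=\frac12 L_{x^3}$ is nilpotent of index at most $2^{4n\dim[n,k]}$, where $n$ is the index of nilpotency of the free commutative $K$-algebra on $k$ generators satisfying the identity $x^3=0$.
   Context: Algebras are nonassociative and not assumed unital. For $x$ in a commutative algebra $A$, $L_x:A\to A$ denotes the multiplication operator $L_x(a)=xa$, and $x^3=x(xx)$. The identity $L_x^3=\frac12 L_{x^3}$ means $x(x(xa))=\frac12\,x^3a$ for all $x,a\in A$. An algebra is nilpotent of index at most $N$ if every product of $N$ or more of its elements, with any arrangement of parentheses, is zero; the index of nilpotency is the least such $N$. An algebra is locally nilpotent if each of its finitely generated subalgebras is nilpotent. The free commutative $K$-algebra on $k$ generators satisfying $x^3=0$ is the quotient of the (absolutely) free commutative nonassociative $K$-algebra (without unit) on $k$ generators by the ideal generated by all cubes $x^3$ of its elements (this algebra is nilpotent). For positive integers $n,k$, $\dim[n,k]$ denotes the number of distinct commutative nonassociative monomials of degree less than $n$ in $k$ generators (each generator having degree $1$), i.e. the dimension of the subspace of the (absolutely) free commutative nonassociative algebra on $k$ generators spanned by the monomials of degree less than $n$. *)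

(* Defs.v *)
From HB Require Import structures.
From mathcomp Require Import all_boot all_order all_algebra.
From mathcomp Require Import generic_quotient ring_quotient finmap.
From mathcomp Require Import boolp classical_sets functions cardinality.
From mathcomp.multinomials Require Import monalg.

Set Implicit Arguments.
Unset Strict Implicit.
Unset Printing Implicit Defensive.

Import GRing.Theory.

Local Open Scope classical_set_scope.
Local Open Scope ring_scope.
Local Open Scope quotient_scope.

(* Right distributivity and right scaling follow from commutativity. *)
HB.mixin Record Lmodule_isCommNAAlgebra (K : fieldType) A
    of GRing.Lmodule K A := {
  namul : A -> A -> A;
  namulC : commutative namul;
  namulDl : left_distributive namul +%R;
  namulZl : forall (a : K) (x y : A), namul (a *: x) y = a *: namul x y
}.

#[short(type="commNAAlgType")]
HB.structure Definition CommNAAlgebra (K : fieldType) :=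
  { A of GRing.Lmodule K A & Lmodule_isCommNAAlgebra K A }.

Notation "x ** y" := (namul x y)
  (at level 40, left associativity) : ring_scope.

(* Parenthesized products: nonempty binary trees with labelled leaves. *)
Inductive paren (T : Type) : Type :=
| PLeaf of T
| PNode of paren T & paren T.

Fixpoint leaves (T : Type) (t : paren T) : seq T :=
  match t with
  | PLeaf x => [:: x]
  | PNode u v => leaves u ++ leaves v
  end.

Definition pdeg (T : Type) (t : paren T) : nat := size (leaves t).

Section ParenChoice.
Variable T : choiceType.

Fixpoint paren_encode (t : paren T) : GenTree.tree T :=
  match t with
  | PLeaf x => GenTree.Leaf x
  | PNode u v => GenTree.Node 0 [:: paren_encode u; paren_encode v]
  end.

Fixpoint paren_decode (t : GenTree.tree T) : option (paren T) :=
  match t with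
  | GenTree.Leaf x => Some (PLeaf x)
  | GenTree.Node _ [:: u; v] =>
      if (paren_decode u, paren_decode v) is (Some u', Some v')
      then Some (PNode u' v') else None
  | _ => None
  end.

Lemma paren_encodeK : pcancel paren_encode paren_decode.
Proof. by elim=> //= u -> v ->. Qed.

HB.instance Definition _ := Choice.copy (paren T) (pcan_type paren_encodeK).

End ParenChoice.

Section Algebra.
Variables (K : fieldType) (A : commNAAlgType K).

Definition cube (x : A) : A := x ** (x ** x).

Definition L3_identity : Prop :=
  forall x a : A, x ** (x ** (x ** a)) = 2%:R^-1 *: (cube x ** a).

Definition is_subspace (S : set A) : Prop :=
  S 0 /\ forall (a : K) (x y : A), S x -> S y -> S (a *: x + y).

Definition is_subalgebra (S : set A) : Prop :=
  is_subspace S /\ forall x y, S x -> S y -> S (x ** y).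

Definition is_ideal (S : set A) : Prop :=
  is_subspace S /\ forall x y, S y -> S (x ** y).

Definition subalgebra_gen (X : set A) : set A := smallest is_subalgebra X.

Definition ideal_gen (X : set A) : set A := smallest is_ideal X.

Definition generated_by (k : nat) : Prop :=
  exists g : 'I_k -> A, subalgebra_gen (range g) = [set: A].

Fixpoint peval (t : paren A) : A :=
  match t with
  | PLeaf x => x
  | PNode u v => peval u ** peval v
  end.

Definition nil_index_le (S : set A) (N : nat) : Prop :=
  forall t : paren A,
    (forall x, x \in leaves t -> S x) -> (N <= pdeg t)%N -> peval t = 0.

Definition nilpotent (S : set A) : Prop := exists N, nil_index_le S N.

Definition nil_index (S : set A) (n : nat) : Prop :=
  nil_index_le S n /\ forall m, nil_index_le S m -> (n <= m)%N.

Definition locally_nilpotent : Prop :=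
  forall X : set A, finite_set X -> nilpotent (subalgebra_gen X).

End Algebra.

Arguments generated_by {K} A k.
Arguments L3_identity {K} A.
Arguments locally_nilpotent {K} A.

Section CommutativeMonomials.
Variable T : choiceType.

Fixpoint ceq (s t : paren T) : bool :=
  match s, t with
  | PLeaf x, PLeaf y => x == y
  | PNode a b, PNode c d => (ceq a c && ceq b d) || (ceq a d && ceq b c)
  | _, _ => false
  end.

Lemma ceq_refl : reflexive ceq.
Proof. by elim=> [x|u IHu v IHv] /=; rewrite ?eqxx ?IHu ?IHv. Qed.

Lemma ceq_sym : symmetric ceq.
Proof.
elim=> [x|a IHa b IHb] [y|c d] //=.
by rewrite (IHa c) (IHb d) (IHa d) (IHb c) [ceq d a && _]andbC.
Qed.

Lemma ceq_trans : transitive ceq.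
Proof.
move=> t s u; elim: t s u => [y|c IHc d IHd] [x|a b] [z|e f] //=.
  by move=> /eqP-> /eqP->.
case/orP=> /andP[ac bd] /orP[]/andP[ce df]; apply/orP.
- by left; rewrite (IHc _ _ ac ce) (IHd _ _ bd df).
- by right; rewrite (IHc _ _ ac ce) (IHd _ _ bd df).
- by right; rewrite (IHd _ _ ac df) (IHc _ _ bd ce).
- by left; rewrite (IHd _ _ ac df) (IHc _ _ bd ce).
Qed.

Canonical ceq_equiv := EquivRel ceq ceq_refl ceq_sym ceq_trans.

(* Commutative nonassociative monomials (without unit) in the generators T. *)
Definition cmonom := {eq_quot ceq}.

HB.instance Definition _ := Choice.on cmonom.
HB.instance Definition _ := EqQuotient.on cmonom.

Definition cvar (x : T) : cmonom := \pi_cmonom (PLeaf x).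

Definition cmul (u v : cmonom) : cmonom :=
  \pi_cmonom (PNode (repr u) (repr v)).

Definition cdeg (u : cmonom) : nat := pdeg (repr u).

Lemma cmul_pi (s t : paren T) :
  cmul (\pi_cmonom s) (\pi_cmonom t) = \pi_cmonom (PNode s t).
Proof.
apply/eqP; rewrite eqmodE /= -!eqmodE.
by rewrite !reprK !eqxx.
Qed.

Lemma cmulC : commutative cmul.
Proof. by move=> u v; apply/eqP; rewrite eqmodE /= !ceq_refl orbT. Qed.

Lemma ceq_pdeg (s t : paren T) : ceq s t -> pdeg s = pdeg t.
Proof.
rewrite /pdeg; elim: s t => [x|a IHa b IHb] [y|c d] //=.
rewrite !size_cat => /orP[]/andP[h1 h2]; rewrite (IHa _ h1) (IHb _ h2) //.
by rewrite addnC.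
Qed.

Lemma cdeg_pi (s : paren T) : cdeg (\pi_cmonom s) = pdeg s.
Proof. by apply: ceq_pdeg; rewrite -eqmodE reprK. Qed.

End CommutativeMonomials.

Definition cmonom_lt (n k : nat) : set (cmonom 'I_k) :=
  [set u | (cdeg u < n)%N].

Arguments cmonom_lt n k : clear implicits.

Lemma pdeg_gt0 (T : Type) (t : paren T) : (0 < pdeg t)%N.
Proof.
by elim: t => // u IHu v IHv; rewrite /pdeg /= size_cat addn_gt0 (IHu : is_true (0 < size _)%N).
Qed.

Lemma finite_cmonom_lt (n k : nat) : finite_set (cmonom_lt n k).
Proof.
have fin : finite_set [set t : paren 'I_k | (pdeg t < n)%N].
  elim: n => [|n IHn].
    by rewrite (_ : mkset _ = set0) //; apply/seteqP; split.
  apply: (@sub_finite_set _ _ (range (@PLeaf 'I_k) `|`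
     (fun p => PNode p.1 p.2) @` ([set t | (pdeg t < n)%N] `*` [set t | (pdeg t < n)%N]))).
    move=> [x|u v] /=; first by left; exists x.
    rewrite /pdeg /= size_cat ltnS => uv; right; exists (u, v) => //=.
    have u0 : (0 < size (leaves u))%N by exact: pdeg_gt0.
    have v0 : (0 < size (leaves v))%N by exact: pdeg_gt0.
    by rewrite -(ltn_add2l (size (leaves u))) in v0;
       rewrite -(ltn_add2r (size (leaves v))) in u0;
       rewrite addn0 in v0; split;
       [exact: leq_trans v0 uv | exact: leq_trans u0 uv].
  rewrite finite_setU; split; first by apply: finite_image; exact: finite_finset.
  by apply: finite_image; exact: finite_setX.
apply: sub_finite_set (finite_image (\pi_(cmonom 'I_k)) fin) => u /= un.
by exists (repr u) => //; rewrite reprK.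
Qed.

(* [dim[n,k]]; see [finite_cmonom_lt] for the finiteness of the set counted. *)
Definition dim_cmonom (n k : nat) : nat := #|` fset_set (cmonom_lt n k)|%fset.

Section FreeCommutative.
Variables (K : fieldType) (k : nat).

Definition freeComm := {malg K[cmonom 'I_k]}.

HB.instance Definition _ := GRing.Lmodule.on freeComm.

Definition freeComm_mul (f g : freeComm) : freeComm :=
  \sum_(u <- msupp f) \sum_(v <- msupp g) << f@_u * g@_v *g cmul u v >>.

Lemma freeComm_mulEw (f g : freeComm) (D E : {fset cmonom 'I_k}) :
  (msupp f `<=` D)%fset -> (msupp g `<=` E)%fset ->
  freeComm_mul f g = \sum_(u <- D) \sum_(v <- E) << f@_u * g@_v *g cmul u v >>.
Proof.
move=> fD gE; rewrite /freeComm_mul (big_fset_incl _ fD) /=; last first.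
  move=> u _ uf; apply: big1 => v _.
  by rewrite mcoeff_outdom // mul0r monalgU0.
apply: eq_bigr => u _; rewrite (big_fset_incl _ gE) //= => v _ vg.
by rewrite [g@_v]mcoeff_outdom // mulr0 monalgU0.
Qed.

Lemma freeComm_mulC : commutative freeComm_mul.
Proof.
move=> f g; rewrite /freeComm_mul exchange_big /=.
by apply: eq_bigr => u _; apply: eq_bigr => v _; rewrite mulrC cmulC.
Qed.

Lemma freeComm_mulDl : left_distributive freeComm_mul +%R.
Proof.
move=> f g h; pose D := (msupp f `|` msupp g)%fset.
rewrite (freeComm_mulEw (D := D) (msuppD_le f g) (fsubset_refl _)).
rewrite (@freeComm_mulEw f h D (msupp h)) ?fsubsetUl ?fsubset_refl //.
rewrite (@freeComm_mulEw g h D (msupp h)) ?fsubsetUr ?fsubset_refl //.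
rewrite -big_split; apply: eq_bigr => u _ /=.
rewrite -big_split; apply: eq_bigr => v _ /=.
by rewrite mcoeffD mulrDl monalgUD.
Qed.

Lemma freeComm_mulZl (a : K) (f g : freeComm) :
  freeComm_mul (a *: f) g = a *: freeComm_mul f g.
Proof.
rewrite (freeComm_mulEw (msuppZ_le a f) (fsubset_refl _)).
rewrite scaler_sumr; apply: eq_bigr => u _.
rewrite scaler_sumr; apply: eq_bigr => v _.
by apply/malgP => w; rewrite !(mcoeffZ, mcoeffU) -mulrA mulrnAr.
Qed.

HB.instance Definition _ := Lmodule_isCommNAAlgebra.Build K freeComm
  freeComm_mulC freeComm_mulDl freeComm_mulZl.

End FreeCommutative.

Section QuotientAlgebra.
Variables (K : fieldType) (A : commNAAlgType K) (X : set A).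

Lemma ideal_gen_is_ideal : is_ideal (ideal_gen X).
Proof.
split; first split=> [S [[[]]]//|a x y Ix Iy S [idS XS]].
  have [[_ SL] _] := idS; apply: SL; [exact: Ix|exact: Iy].
by move=> x y Iy S [idS XS]; case: (idS) => _; apply; apply: Iy.
Qed.

Definition ideal_genb : pred A := fun x => `[< ideal_gen X x >].

Lemma ideal_genb_zmod_closed : zmod_closed ideal_genb.
Proof.
have [[I0 IL] _] := ideal_gen_is_ideal.
split=> [|x y]; first exact/asboolP.
rewrite !unfold_in => /asboolP Ix /asboolP Iy; apply/asboolP.
by rewrite addrC -scaleN1r; apply: IL.
Qed.

HB.instance Definition _ := GRing.isZmodClosed.Build A ideal_genb
  ideal_genb_zmod_closed.

Definition idealZ : zmodClosed A := GRing.ZmodClosed.clone A ideal_genb _.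

(* The quotient of A by the ideal generated by X. *)
Definition quotAlg : Type := Quotient.quot idealZ.

HB.instance Definition _ := GRing.Zmodule.on quotAlg.
HB.instance Definition _ := EqQuotient.on quotAlg.

Local Notation pi := (\pi_quotAlg).

Lemma quotAlg_eqP (x y : A) : pi x = pi y <-> ideal_gen X (x - y).
Proof.
have -> : (pi x = pi y) <-> ideal_genb (x - y).
  by rewrite [ideal_genb _](Quotient.idealrBE idealZ); split=> /eqP.
by split=> /asboolP.
Qed.

Lemma quotAlg_piD (x y : A) : pi (x + y) = pi x + pi y.
Proof. exact: (raddfD \pi_(Quotient.quot idealZ)). Qed.

Definition quotAlg_scale (a : K) (u : quotAlg) : quotAlg := pi (a *: repr u).

Definition quotAlg_mul (u v : quotAlg) : quotAlg := pi (repr u ** repr v).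

Lemma quotAlg_scale_pi (a : K) (x : A) : quotAlg_scale a (pi x) = pi (a *: x).
Proof.
apply/quotAlg_eqP; rewrite -scalerBr -[_ *: _]addr0.
have [[I0 IL] _] := ideal_gen_is_ideal.
by apply: IL => //; apply/quotAlg_eqP; rewrite reprK.
Qed.

Lemma quotAlg_mul_pi (x y : A) : quotAlg_mul (pi x) (pi y) = pi (x ** y).
Proof.
have [_ IM] := ideal_gen_is_ideal.
have mulB (a b c : A) : (a - b) ** c = a ** c - b ** c.
  by rewrite namulDl -scaleN1r namulZl scaleN1r.
transitivity (pi (repr (pi x) ** y)); apply/quotAlg_eqP.
  rewrite ![repr (pi x) ** _]namulC -mulB namulC.
  by apply: IM; apply/quotAlg_eqP; rewrite reprK.
by rewrite -mulB namulC; apply: IM; apply/quotAlg_eqP; rewrite reprK.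
Qed.

Lemma quotAlg_piK (u : quotAlg) : pi (repr u) = u.
Proof. exact: reprK. Qed.

Lemma quotAlg_scaleA a b u :
  quotAlg_scale a (quotAlg_scale b u) = quotAlg_scale (a * b) u.
Proof. by rewrite -[u]quotAlg_piK !quotAlg_scale_pi scalerA. Qed.

Lemma quotAlg_scale1 : left_id 1 quotAlg_scale.
Proof. by move=> u; rewrite -[u]quotAlg_piK quotAlg_scale_pi scale1r. Qed.

Lemma quotAlg_scaleDr : right_distributive quotAlg_scale +%R.
Proof.
move=> a u v; rewrite -[u]quotAlg_piK -[v]quotAlg_piK -quotAlg_piD !quotAlg_scale_pi.
by rewrite scalerDr quotAlg_piD.
Qed.

Lemma quotAlg_scaleDl u : {morph quotAlg_scale^~ u : a b / a + b}.
Proof.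
by move=> a b; rewrite -[u]quotAlg_piK !quotAlg_scale_pi scalerDl quotAlg_piD.
Qed.

HB.instance Definition _ := GRing.Zmodule_isLmodule.Build K quotAlg
  quotAlg_scaleA quotAlg_scale1 quotAlg_scaleDr quotAlg_scaleDl.

Lemma quotAlg_mulC : commutative quotAlg_mul.
Proof. by move=> u v; rewrite /quotAlg_mul namulC. Qed.

Lemma quotAlg_mulDl : left_distributive quotAlg_mul +%R.
Proof.
move=> u v w; rewrite -[u]quotAlg_piK -[v]quotAlg_piK -[w]quotAlg_piK -quotAlg_piD.
by rewrite !quotAlg_mul_pi namulDl quotAlg_piD.
Qed.

Lemma quotAlg_mulZl (a : K) (u v : quotAlg) :
  quotAlg_mul (a *: u) v = a *: quotAlg_mul u v.
Proof.
rewrite -[u]quotAlg_piK -[v]quotAlg_piK [a *: pi _]quotAlg_scale_pi !quotAlg_mul_pi namulZl.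
by rewrite [RHS]quotAlg_scale_pi.
Qed.

HB.instance Definition _ := Lmodule_isCommNAAlgebra.Build K quotAlg
  quotAlg_mulC quotAlg_mulDl quotAlg_mulZl.

End QuotientAlgebra.

(* The free commutative algebra on k generators satisfying x^3 = 0. *)
Definition freeCube0 (K : fieldType) (k : nat) : commNAAlgType K :=
  quotAlg (range (@cube K (freeComm K k))).

(* Main.v *)
(** Write [L_x] for multiplication by [x] and [J(x,y,z) = x(yz) + y(zx) + z(xy)].

    Algebras with [x^3 = 0].  Here [J = 0], that is [L_{xy} = -(L_x L_y + L_y L_x)],
    and [L_x L_y L_z] summed over all orders is [0].  These relations make every
    finitely generated algebra of multiplications nilpotent, by induction on the
    number of generators: to adjoin [c] to a nilpotent family [a, E], one shows
    that every product of letters [c, a, E] is a combination of products [w u]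
    with [w] a word in [c, ca, E] and [u] a word in [a, E]; this replaces [a] by
    [ca], and since [c(c(cx)) = 0] the family consists of zeros after three
    rounds of replacements.

    Algebras with [L_x^3 = L_{x^3} / 2].  The span [C] of the cubes is an ideal
    with [C C = 0], and products of [n] or more elements lie in [C].  On [C], modulo
    shorter words of the same degree, the anticommutators [L_x L_y + L_y L_x] are
    central and the symmetrised products of three multiplications vanish, so a
    word with a letter repeated three times is a combination of shorter ones.
    Letters of degree at least [n] kill [C]; hence so does every word of degree
    exceeding [2 (n-1) dim[n,k]]. *)

Require Import Defs.
From HB Require Import structures.
From mathcomp Require Import all_boot all_order all_algebra.
From mathcomp Require Import zify generic_quotient finmap.
From mathcomp Require Import boolp classical_sets functions cardinality.
From mathcomp.multinomials Require Import monalg.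
(* Again, since [monalg] has its own [cmonom]. *)
Require Import Defs.

Set Implicit Arguments.
Unset Strict Implicit.
Unset Printing Implicit Defensive.

Import GRing.Theory.

Local Open Scope classical_set_scope.
Local Open Scope ring_scope.
Local Open Scope quotient_scope.

(** * Bilinearity of the multiplication and relabelling of parenthesised products *)

Section NamulTheory.
Variables (K : fieldType) (A : commNAAlgType K).
Implicit Types x y z : A.

Lemma namulDr x y z : x ** (y + z) = x ** y + x ** z.
Proof. by rewrite namulC namulDl (namulC y) (namulC z). Qed.

Lemma namulZr (a : K) x y : x ** (a *: y) = a *: (x ** y).
Proof. by rewrite namulC namulZl namulC. Qed.

Lemma namul0l x : 0 ** x = 0.
Proof. by have := namulZl 0 x x; rewrite !scale0r. Qed.

Lemma namul0r x : x ** 0 = 0.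
Proof. by rewrite namulC namul0l. Qed.

Lemma namulMzl x y (m : int) : (x *~ m) ** y = (x ** y) *~ m.
Proof. by rewrite -[x *~ m]scaler_int namulZl scaler_int. Qed.

Lemma namulMzr x y (m : int) : x ** (y *~ m) = (x ** y) *~ m.
Proof. by rewrite namulC namulMzl namulC. Qed.

Lemma namul_suml (I : Type) (r : seq I) (F : I -> A) x :
  (\sum_(i <- r) F i) ** x = \sum_(i <- r) F i ** x.
Proof.
by elim: r => [|i r IH]; rewrite ?big_nil ?namul0l // !big_cons namulDl IH.
Qed.

Lemma namul_sumr (I : Type) (r : seq I) (F : I -> A) x :
  x ** (\sum_(i <- r) F i) = \sum_(i <- r) x ** F i.
Proof. by rewrite namulC namul_suml; apply: eq_bigr => i _; rewrite namulC. Qed.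

End NamulTheory.

Section ParenMap.
Variables (T U : Type) (f : T -> U).

Fixpoint paren_map (t : paren T) : paren U :=
  match t with
  | PLeaf x => PLeaf (f x)
  | PNode s t => PNode (paren_map s) (paren_map t)
  end.

Lemma leaves_paren_map t : leaves (paren_map t) = [seq f x | x <- leaves t].
Proof. by elim: t => //= s -> t ->; rewrite map_cat. Qed.

Lemma pdeg_paren_map t : pdeg (paren_map t) = pdeg t.
Proof. by rewrite /pdeg leaves_paren_map size_map. Qed.

End ParenMap.

Lemma peval_ceq (K : fieldType) (A : commNAAlgType K) (T : choiceType)
    (f : T -> A) (s t : paren T) :
  ceq s t -> peval (paren_map f s) = peval (paren_map f t).
Proof.
elim: s t => [x|a IHa b IHb] [y|c d] //=; first by move/eqP->.
by case/orP=> /andP[/IHa-> /IHb->] //; rewrite namulC.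
Qed.

(** * Deciding identities of commutative nonassociative algebras *)

Inductive nexp :=
| NVar of nat
| NAdd of nexp & nexp
| NMulz of int & nexp
| NMul of nexp & nexp.

(** Integer coefficients make one computation valid over every field. Terms are collected up to
    [ceq], which accounts for commutativity. *)
Definition linform := seq (int * paren nat).

Fixpoint lf_insert (c : int) (t : paren nat) (l : linform) : linform :=
  if l is (d, s) :: l' then
    if ceq t s then (c + d, s) :: l' else (d, s) :: lf_insert c t l'
  else [:: (c, t)].

Definition lf_add (l m : linform) : linform :=
  foldr (fun p => lf_insert p.1 p.2) m l.

Definition lf_scale (c : int) (l : linform) : linform :=
  [seq (c * p.1, p.2) | p <- l].

Definition lf_mul (l m : linform) : linform :=
  foldr (fun p r =>
    lf_add [seq (p.1 * q.1, PNode p.2 q.2) | q <- m] r) [::] l.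

Fixpoint lf_nexp (e : nexp) : linform :=
  match e with
  | NVar i => [:: (1, PLeaf i)]
  | NAdd e f => lf_add (lf_nexp e) (lf_nexp f)
  | NMulz c e => lf_scale c (lf_nexp e)
  | NMul e f => lf_mul (lf_nexp e) (lf_nexp f)
  end.

(** Cancelled terms stay in the list with coefficient 0, so emptiness would be too strict a test. *)
Definition lf_zero (l : linform) : bool := all (fun p => p.1 == 0) l.

Section NexpEval.
Variables (K : fieldType) (A : commNAAlgType K) (env : seq A).

Definition tree_eval (t : paren nat) : A := peval (paren_map (nth 0 env) t).

Fixpoint nexp_eval (e : nexp) : A :=
  match e with
  | NVar i => nth 0 env i
  | NAdd e f => nexp_eval e + nexp_eval f
  | NMulz c e => nexp_eval e *~ c
  | NMul e f => nexp_eval e ** nexp_eval f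
  end.

Definition lf_eval (l : linform) : A := \sum_(p <- l) tree_eval p.2 *~ p.1.

Lemma lf_eval_insert c t l :
  lf_eval (lf_insert c t l) = tree_eval t *~ c + lf_eval l.
Proof.
rewrite /lf_eval; elim: l => [|[d s] l IH] /=; first by rewrite !big_cons.
case: ifP => [/(peval_ceq (nth 0 env)) e|_]; rewrite !big_cons /=.
  by rewrite /tree_eval e mulrzDr addrA.
by rewrite IH addrCA.
Qed.

Lemma lf_eval_add l m : lf_eval (lf_add l m) = lf_eval l + lf_eval m.
Proof.
elim: l => [|p l IH] /=; first by rewrite /lf_eval big_nil add0r.
by rewrite lf_eval_insert IH /lf_eval big_cons addrA.
Qed.

Lemma lf_eval_mul l m : lf_eval (lf_mul l m) = lf_eval l ** lf_eval m.
Proof.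
elim: l => [|p l IH] /=; first by rewrite /lf_eval big_nil namul0l.
rewrite lf_eval_add IH [in RHS]/lf_eval big_cons namulDl; congr (_ + _).
rewrite /lf_eval big_map namul_sumr; apply: eq_bigr => q _ /=.
by rewrite namulMzl namulMzr mulrzAC -mulrzA.
Qed.

Lemma lf_eval_nexp e : lf_eval (lf_nexp e) = nexp_eval e.
Proof.
elim: e => [i|e IHe f IHf|c e IHe|e IHe f IHf] /=.
- by rewrite /lf_eval big_seq1.
- by rewrite lf_eval_add IHe IHf.
- rewrite -IHe /lf_eval big_map mulrz_suml; apply: eq_bigr => p _ /=.
  by rewrite mulrC mulrzA.
- by rewrite lf_eval_mul IHe IHf.
Qed.

Lemma nexp_eval0 e : lf_zero (lf_nexp e) -> nexp_eval e = 0.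
Proof.
rewrite -lf_eval_nexp /lf_eval => /allP e0.
by rewrite big_seq; apply: big1 => p /e0/eqP->.
Qed.

End NexpEval.

Ltac nalg_index x env :=
  lazymatch env with
  | x :: _ => constr:(O)
  | _ :: ?env' => let n := nalg_index x env' in constr:(S n)
  end.

Ltac nalg_reify env t :=
  lazymatch t with
  | namul ?x ?y =>
      let e := nalg_reify env x in let f := nalg_reify env y in constr:(NMul e f)
  | GRing.add ?x ?y =>
      let e := nalg_reify env x in let f := nalg_reify env y in constr:(NAdd e f)
  | GRing.opp ?x => let e := nalg_reify env x in constr:(NMulz (-1) e)
  | GRing.natmul ?x ?n => let e := nalg_reify env x in constr:(NMulz (Posz n) e)
  | _ => let n := nalg_index t env in constr:(NVar n)
  end.

(** The atoms are listed in [env]. The difference of the two sides is reified; opposites and natural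
    multiples are convertible to integer multiples. *)
Ltac nalg env :=
  apply: subr0_eq;
  lazymatch goal with |- ?t = _ =>
    let env' := eval simpl in env in
    let e := nalg_reify env' t in
    exact: (@nexp_eval0 _ _ env e (ltac:(vm_compute; reflexivity)))
  end.

(** * The ideal spanned by the cubes *)

Section CubeSpan.
Variables (K : fieldType) (A : commNAAlgType K).
Hypotheses (char2 : 2%N \notin [pchar K]) (char3 : 3%N \notin [pchar K]).
Implicit Types x y z a c : A.

Lemma natf2_neq0 : 2%:R != 0 :> K.
Proof. by move: char2; rewrite inE /=. Qed.

Lemma natf3_neq0 : 3%:R != 0 :> K.
Proof. by move: char3; rewrite inE /=. Qed.

Lemma mulrn_eq0 (n : nat) x : n%:R != 0 :> K -> x *+ n = 0 -> x = 0.
Proof.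
by move=> n0; rewrite -scaler_nat => /eqP;
   rewrite scaler_eq0 (negPf n0) => /eqP.
Qed.

Definition jac x y z := x ** (y ** z) + y ** (z ** x) + z ** (x ** y).

(** Polarisation: inclusion-exclusion leaves the six products multilinear in [x], [y], [z], and
    commutativity makes them equal in pairs. *)
Lemma jac_polar x y z :
  jac x y z *+ 2 = cube (x + y + z) - cube (x + y) - cube (x + z) - cube (y + z)
    + cube x + cube y + cube z.
Proof. by rewrite /jac /cube; nalg [:: x; y; z]. Qed.

(* The full linearisation of [2 x(x(xa)) - x^3 a], up to the factor [2]. *)
Definition l3_defect x y z a :=
  x ** (y ** (z ** a)) + x ** (z ** (y ** a)) + y ** (x ** (z ** a))
  + y ** (z ** (x ** a)) + z ** (x ** (y ** a)) + z ** (y ** (x ** a))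
  - jac x y z ** a.

Section L3.
Hypothesis L3 : L3_identity A.

Lemma l3_double x a : (x ** (x ** (x ** a))) *+ 2 - cube x ** a = 0.
Proof.
by rewrite L3 -[_ *+ 2]scaler_nat scalerA mulfV ?scale1r ?subrr ?natf2_neq0.
Qed.

Lemma l3_defect0 x y z a : l3_defect x y z a = 0.
Proof.
apply: (mulrn_eq0 natf2_neq0).
pose d t := (t ** (t ** (t ** a))) *+ 2 - cube t ** a.
transitivity (d (x + y + z) - d (x + y) - d (x + z) - d (y + z)
    + d x + d y + d z); last by rewrite /d !l3_double !subr0 !addr0.
by rewrite /d /l3_defect /jac /cube; nalg [:: x; y; z; a].
Qed.

(** This is [l3_defect] with [c] in the third slot and [z] as the argument. On the left stands the
    commutator of [L_x L_y + L_y L_x] with [L_z], applied to [c]; on the right stand only words of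
    at most two multiplications. *)
Lemma l3_central x y z c :
  x ** (y ** (z ** c)) + y ** (x ** (z ** c))
  - (z ** (x ** (y ** c)) + z ** (y ** (x ** c))) =
  z ** ((x ** y) ** c) - x ** ((y ** z) ** c) - y ** ((x ** z) ** c)
  - (x ** (y ** z)) ** c - (y ** (x ** z)) ** c.
Proof.
rewrite -[RHS]addr0 -(l3_defect0 x y c z) /l3_defect /jac.
by nalg [:: x; y; z; c].
Qed.

Lemma l3_cubic x y z c :
  x ** (y ** (z ** c)) + x ** (z ** (y ** c)) + y ** (x ** (z ** c))
  + y ** (z ** (x ** c)) + z ** (x ** (y ** c)) + z ** (y ** (x ** c)) =
  (x ** (y ** z)) ** c + (y ** (z ** x)) ** c + (z ** (x ** y)) ** c.
Proof. by rewrite -!namulDl; apply: subr0_eq; apply: l3_defect0. Qed.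

(** Values of [jac] are combinations of cubes, so this is what makes the span of the cubes an
    ideal. *)
Lemma namul_cube x y : (y ** cube x) *+ 2 = jac x x (x ** y) - jac (x ** x) x y.
Proof.
rewrite -[RHS]subr0 -(l3_double x y) -[RHS]addr0 -(l3_defect0 x x y x).
by rewrite /l3_defect /jac /cube; nalg [:: x; y].
Qed.

(* The coefficients were found by linear algebra in bidegree (3, 3). *)
Lemma cube_mul_cube x y : cube x ** cube y = 0.
Proof.
have n12 : 12%:R != 0 :> K.
  by rewrite (natrM _ 4 3) (natrM _ 2 2) !mulf_neq0 ?natf2_neq0 ?natf3_neq0.
apply: (mulrn_eq0 n12); pose D := l3_defect.
have -> : (cube x ** cube y) *+ 12 =
    - (D x x x (y ** (y ** y))) *+ 4
    - (x ** (D x x y (y ** y))) *+ 3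
    - (x ** (D x y (y ** y) x)) *+ 6
    - (x ** (D x x (y ** y) y)) *+ 6
    + (x ** (D x y (x ** y) y)) *+ 12
    - (D x x y (y ** (x ** y))) *+ 3
    - (D x y (x ** (y ** y)) x) *+ 6
    - (D x y (y ** (x ** y)) x) *+ 6
    - (D x x (x ** (y ** y)) y) *+ 6
    - (D x x (y ** (x ** y)) y) *+ 6
    + (x ** (x ** (D x y y y))) *+ 18
    - (D x x y (x ** (y ** y))) *+ 3
    + (D x y (x ** (x ** y)) y) *+ 12
    + (y ** (y ** (D x x x y))) *+ 2
    + (y ** (y ** (D x x y x))) *+ 3
    + (D x y (y ** (x ** x)) y) *+ 3
    + (x ** (y ** (D x x y y))) *+ 3.
  by rewrite /D /l3_defect /jac /cube; nalg [:: x; y].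
by rewrite /D !(l3_defect0, namul0r, mul0rn, oppr0, addr0).
Qed.

Definition cube_span : set A := smallest (@is_subspace K A) (range (@cube K A)).

Lemma cube_spanP (P : set A) c :
  is_subspace P -> (forall x, P (cube x)) -> cube_span c -> P c.
Proof. by move=> sP cP; apply; split=> // _ [x _ <-]. Qed.

Lemma cube_span_subspace : is_subspace cube_span.
Proof.
split=> [S [[]]//|a x y Cx Cy S [sS XS]].
by case: (sS) => _; apply; [apply: Cx | apply: Cy].
Qed.

Lemma cube_spanZ (a : K) x : cube_span x -> cube_span (a *: x).
Proof.
by have [C0 CL] := cube_span_subspace => Cx; rewrite -[_ *: _]addr0; apply: CL.
Qed.

Lemma cube_spanD x y : cube_span x -> cube_span y -> cube_span (x + y).
Proof.
by have [_ CL] := cube_span_subspace => Cx Cy; rewrite -[x]scale1r; apply: CL.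
Qed.

Lemma cube_spanB x y : cube_span x -> cube_span y -> cube_span (x - y).
Proof.
by move=> Cx Cy; rewrite -scaleN1r; apply: cube_spanD => //; apply: cube_spanZ.
Qed.

Lemma cube_span_cube x : cube_span (cube x).
Proof. by move=> S [_]; apply; exists x. Qed.

Lemma cube_span_half x : cube_span (x *+ 2) -> cube_span x.
Proof.
by move=> /(cube_spanZ 2%:R^-1); rewrite -scaler_nat scalerA mulVf ?scale1r.
Qed.

Lemma cube_span_jac x y z : cube_span (jac x y z).
Proof.
apply: cube_span_half; rewrite jac_polar.
by do ![exact: cube_span_cube | apply: cube_spanB | apply: cube_spanD].
Qed.

Lemma cube_span_mull y c : cube_span c -> cube_span (y ** c).
Proof.
apply: (cube_spanP (P := [set c | cube_span (y ** c)])) => [|x] /=.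
  split=> [|a u v Cu Cv] /=; first by rewrite namul0r; case: cube_span_subspace.
  by rewrite namulDr namulZr; apply: cube_spanD => //; apply: cube_spanZ.
apply: cube_span_half; rewrite namul_cube.
by apply: cube_spanB; apply: cube_span_jac.
Qed.

Lemma cube_span_mul0 c d : cube_span c -> cube_span d -> c ** d = 0.
Proof.
move=> Cc Cd; apply: (cube_spanP (P := [set c | c ** d = 0])) Cc => [|x] /=.
  split=> [|a u v] /=; first by rewrite namul0l.
  by rewrite namulDl namulZl => -> ->; rewrite scaler0 addr0.
apply: (cube_spanP (P := [set d | cube x ** d = 0])) Cd => [|y] /=.
  split=> [|a u v] /=; first by rewrite namul0r.
  by rewrite namulDr namulZr => -> ->; rewrite scaler0 addr0.
exact: cube_mul_cube.
Qed.

End L3.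
End CubeSpan.

(** * Algebras whose cubes vanish *)

Section LeftProducts.
Variables (K : fieldType) (A : commNAAlgType K).
Implicit Types (x y z : A) (w : seq A).

Definition lmuls w z : A := foldr namul z w.

Lemma lmuls_cat v w z : lmuls (v ++ w) z = lmuls v (lmuls w z).
Proof. exact: foldr_cat. Qed.

Lemma lmuls0 w : lmuls w 0 = 0.
Proof. by elim: w => //= y w ->; rewrite namul0r. Qed.

Lemma lmulsD w x y : lmuls w (x + y) = lmuls w x + lmuls w y.
Proof. by elim: w => //= u w ->; rewrite namulDr. Qed.

Lemma lmulsZ w (a : K) x : lmuls w (a *: x) = a *: lmuls w x.
Proof. by elim: w => //= u w ->; rewrite namulZr. Qed.

Lemma lmulsN w x : lmuls w (- x) = - lmuls w x.
Proof. by rewrite -scaleN1r lmulsZ scaleN1r. Qed.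

Lemma lmulsB w x y : lmuls w (x - y) = lmuls w x - lmuls w y.
Proof. by rewrite lmulsD lmulsN. Qed.

Definition mult_nilpotent (E : seq A) : Prop :=
  exists N, forall w z, {subset w <= E} -> (N <= size w)%N -> lmuls w z = 0.

Lemma subset_cons_inv (y : A) w (E : seq A) :
  {subset y :: w <= E} -> y \in E /\ {subset w <= E}.
Proof.
move=> s; split; first by apply: s; rewrite mem_head.
by move=> u uw; apply: s; rewrite inE uw orbT.
Qed.

End LeftProducts.

Section CubeZero.
Variables (K : fieldType) (A : commNAAlgType K).
Hypotheses (char2 : 2%N \notin [pchar K]) (cube0 : forall x : A, cube x = 0).
Implicit Types (x y z r : A) (E w : seq A).

Lemma jac_eq0 x y z : jac x y z = 0.
Proof.
apply: (mulrn_eq0 (natf2_neq0 char2)).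
by rewrite jac_polar !cube0 !subr0 !addr0.
Qed.

Lemma namul_jj x y r : (x ** y) ** r = - (x ** (y ** r)) - y ** (x ** r).
Proof. by rewrite -[LHS]subr0 -(jac_eq0 x y r) /jac; nalg [:: x; y; r]. Qed.

(** In the combination of [jac] values below, products such as [(xy)(zr)], [r(z(xy))] and [z(r(xy))]
    cancel, and each of the six words occurs twice. *)
Lemma namul3_jj x y z r :
  x ** (y ** (z ** r)) + x ** (z ** (y ** r)) + y ** (x ** (z ** r))
  + y ** (z ** (x ** r)) + z ** (x ** (y ** r)) + z ** (y ** (x ** r)) = 0.
Proof.
apply: (mulrn_eq0 (natf2_neq0 char2)).
transitivity (jac x y (z ** r) + jac y z (x ** r) + jac z x (y ** r)
  - jac (x ** y) z r - jac (y ** z) x r - jac (z ** x) y r + r ** jac x y z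
  + z ** jac x y r + x ** jac y z r + y ** jac z x r); last first.
  by rewrite !(jac_eq0, namul0r, subr0, addr0).
by rewrite /jac; nalg [:: x; y; z; r].
Qed.

Section Elimination.
Variables (a c : A) (E : seq A).

Inductive elim_mult : nat -> A -> Prop :=
| ElimC : elim_mult 1 c
| ElimCA : elim_mult 2 (c ** a)
| ElimX m x y of x \in E & elim_mult m y : elim_mult m.+1 (x ** y).

(* [elim_mult m y]: [y] is [c] or [ca] multiplied successively by letters of
   [E], and has degree [m], where [ca] counts twice. Moving letters of [E] to the
   right across such a [y] only produces more of them, so they generate, together
   with words in [a :: E], the span of the products [w u] of the header. *)
Inductive elim_span (z : A) : nat -> A -> Prop :=
| Elim0 n : elim_span z n 0
| ElimLin n (k : K) x y of elim_span z n x & elim_span z n y :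
    elim_span z n (k *: x + y)
| ElimBase u of {subset u <= a :: E} : elim_span z (size u) (lmuls u z)
| ElimAct m n y r of elim_mult m y & elim_span z n r :
    elim_span z (m + n) (y ** r).

Lemma elim_spanN z n x : elim_span z n x -> elim_span z n (- x).
Proof.
by move=> Rx; rewrite -[- x]addr0 -scaleN1r; apply: ElimLin => //; apply: Elim0.
Qed.

Lemma elim_spanD z n x y :
  elim_span z n x -> elim_span z n y -> elim_span z n (x + y).
Proof. by move=> Rx Ry; rewrite -[x]scale1r; apply: ElimLin. Qed.

Lemma elim_span_letter z n x r :
  x \in E -> elim_span z n r -> elim_span z n.+1 (x ** r).
Proof.
move=> xE; elim=> {n r} [n|n k u v _ Ru _ Rv|u uE|m n y r My Rr Rxr].
- by rewrite namul0r; apply: Elim0.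
- by rewrite namulDr namulZr; apply: ElimLin.
- apply: (@ElimBase z (x :: u)) => t; rewrite inE => /predU1P[->|/uE//].
  by rewrite inE xE orbT.
have -> : x ** (y ** r) = - (y ** (x ** r)) + - ((x ** y) ** r).
  by rewrite namul_jj opprD !opprK addrCA addNr addr0.
apply: elim_spanD; apply: elim_spanN; last first.
  by rewrite -addSn; apply: ElimAct => //; apply: ElimX.
by rewrite -addnS; apply: ElimAct.
Qed.

Lemma elim_mult_gt0 m y : elim_mult m y -> (0 < m)%N.
Proof. by case. Qed.

(** Strong induction on the degree, moving [a] to the right: past [c] it leaves a term in [ca]; past
    [ca] one has [L_a L_{ca} = L_c L_a L_a]; past [x y] the cubic relation leaves [a] acting only on
    terms of lower degree. *)
Lemma elim_span_elim z n r : elim_span z n r -> elim_span z n.+1 (a ** r).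
Proof.
elim/ltn_ind: n r => n IH r Rr.
have {IH} : forall n', (n' < n)%N ->
    forall r, elim_span z n' r -> elim_span z n'.+1 (a ** r) by [].
elim: Rr => {n r} [n|n k u v _ Ru _ Rv|u uE|m n y r My Rr Rar] IH.
- by rewrite namul0r; apply: Elim0.
- by rewrite namulDr namulZr; apply: ElimLin; [apply: Ru | apply: Rv].
- apply: (@ElimBase z (a :: u)) => t; rewrite inE => /predU1P[->|/uE//].
  exact: mem_head.
case: My IH => {m y Rar} [||m x y xE My] IH.
- have -> : a ** (c ** r) = - (c ** (a ** r)) + - ((c ** a) ** r).
    by rewrite namul_jj opprD !opprK addrA addNr add0r.
  apply: elim_spanD; apply: elim_spanN; last by apply: (ElimAct ElimCA Rr).
  by apply: (ElimAct ElimC (IH _ _ _ Rr)).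
- have -> : a ** ((c ** a) ** r) = c ** (a ** (a ** r)).
    apply: subr0_eq; apply: (mulrn_eq0 (natf2_neq0 char2)).
    by rewrite namul_jj -oppr0 -(namul3_jj a a c r); nalg [:: a; c; r].
  have Rar := IH n (leqnSn n.+1) _ Rr.
  exact: (ElimAct ElimC (IH _ (ltnSn _) _ Rar)).
(* The term [a (y (x r))], which would not have lower degree, cancels. *)
have -> : a ** ((x ** y) ** r) = x ** (a ** (y ** r)) + x ** (y ** (a ** r))
    + y ** (a ** (x ** r)) + y ** (x ** (a ** r)).
  by rewrite namul_jj -[LHS]addr0 -(namul3_jj a x y r); nalg [:: a; x; y; r].
have m0 := elim_mult_gt0 My.
have Rar : elim_span z n.+1 (a ** r).
  by apply: IH => //; rewrite addSnnS leq_addl.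
have Rxr := elim_span_letter xE Rr.
do !apply: elim_spanD.
- rewrite addSn; apply: elim_span_letter => //.
  by apply: (IH (m + n)%N); [rewrite addSn | apply: ElimAct].
- by rewrite addSn -addnS; apply: elim_span_letter => //; apply: ElimAct.
- rewrite addSn -!addnS; apply: ElimAct => //; apply: IH => //.
  by rewrite addSn ltnS -[n.+1]add1n leq_add2r.
- by rewrite addSn -!addnS; apply: ElimAct => //; apply: elim_span_letter.
Qed.

Lemma lmuls_elim_span w z :
  {subset w <= [:: c, a & E]} -> elim_span z (size w) (lmuls w z).
Proof.
elim: w => [|y w IH] /=; first by move=> _; apply: (@ElimBase z [::]).
move=> /subset_cons_inv[+ /IH Rw].
rewrite !inE => /or3P[/eqP->|/eqP->|yE].
- exact: (ElimAct ElimC Rw).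
- exact: elim_span_elim.
- exact: elim_span_letter.
Qed.

(** In a term [w u] of degree at least [p + 2q], either [u] has at least [p] letters, or [w]
    accounts for degree more than [2q]; each of its letters counts at most 2, so there are at least
    [q] of them. *)
Lemma mult_nilpotent_elim :
  mult_nilpotent (a :: E) -> mult_nilpotent (c :: rcons E (c ** a)) ->
  mult_nilpotent [:: c, a & E].
Proof.
move=> [p pE] [q qX]; exists (p + 2 * q)%N => w z wE wN.
set X := c :: rcons E (c ** a) in qX.
(* [Z n r]: an element [r] of degree [n] is killed by every word in [X] that could raise the degree
   to [p + 2q], each letter counted as 2. *)
pose Z n r := forall v, {subset v <= X} -> (p + 2 * q <= 2 * size v + n)%N ->
  lmuls v r = 0.
have Zlin n k x y : Z n x -> Z n y -> Z n (k *: x + y).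
  by move=> Zx Zy v vX vN; rewrite lmulsD lmulsZ Zx ?Zy ?scaler0 ?addr0.
have Zact m n x r : x \in X -> (m <= 2)%N -> Z n r -> Z (m + n)%N (x ** r).
  move=> xX m2 Zr v vX vN; have := Zr (rcons v x).
  rewrite -cats1 lmuls_cat; apply.
    by move=> t; rewrite mem_cat inE => /orP[/vX//|/eqP->].
  apply: leq_trans vN _; rewrite size_cat addn1 mulnS.
  by rewrite addnCA -[X in (_ <= X)%N]addnA leq_add2r.
suff Zw : Z (size w) (lmuls w z) by apply: (Zw [::]).
elim: (lmuls_elim_span z wE) => {w wE wN}
  [n|n k x y _ Zx _ Zy|u uE|m n y r My _ Zr].
- by move=> v _ _; rewrite lmuls0.
- exact: Zlin.
- move=> v vX vN.
  case: (leqP p (size u)) => [/pE->//|up]; first by rewrite lmuls0.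
  apply: qX => //; rewrite -(leq_pmul2l (isT : 0 < 2)%N) -(leq_add2l p).
  by apply: leq_trans vN _; rewrite addnC leq_add2r ltnW.
elim: My n r Zr => {m y} [||m x y xE My IH] n r Zr.
- by apply: Zact => //; rewrite mem_head.
- by apply: Zact => //; rewrite inE mem_rcons mem_head orbT.
have xX : x \in X by rewrite inE mem_rcons inE xE !orbT.
rewrite namul_jj -!scaleN1r; apply: (Zlin _ (-1)).
  by rewrite addSn; apply: (Zact 1%N) => //; apply: IH.
rewrite -[_ *: _]addr0; apply: Zlin => [|v _ _]; last by rewrite lmuls0.
by rewrite addSn -addnS; apply: IH; apply: (Zact 1%N).
Qed.

End Elimination.

(** The letters of [E] still have to be multiplied by [c]; those of [F] already have been. Each
    elimination moves one letter, and [nilG] covers the family without [c] that it requires. *)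
Lemma mult_nilpotent_ad c E F :
  (forall G : seq A, size G = (size E + size F)%N -> mult_nilpotent G) ->
  mult_nilpotent (c :: F ++ map (namul c) E) -> mult_nilpotent (c :: E ++ F).
Proof.
elim: E F => [|a E IH] F nilG /=; first by rewrite cats0.
move=> nilF; apply: mult_nilpotent_elim.
  by apply: nilG; rewrite /= size_cat.
rewrite rcons_cat; apply: IH => [G|]; last by rewrite cat_rcons.
by rewrite size_rcons addnS -addSn; apply: nilG.
Qed.

Lemma mult_nilpotent_jj E : mult_nilpotent E.
Proof.
elim: {E}(size E) {-2}E (erefl (size E)) => [|k IH] E.
  move/size0nil->; exists 1%N => -[//|y w] z /subset_cons_inv[].
  by rewrite in_nil.
case: E => // c E [Ek].
have step F : size F = k ->
    mult_nilpotent (c :: map (namul c) F) -> mult_nilpotent (c :: F).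
  move=> Fk nilF; rewrite -[F]cats0; apply: mult_nilpotent_ad => //.
  by move=> G; rewrite addn0 Fk; apply: IH.
do 3!(apply: (step _); first by rewrite ?size_map).
(* Equal letters in [namul3_jj] would give the factor 6; the combination below gives 4, which
   [char2] cancels. *)
have c3 x : c ** (c ** (c ** x)) = 0.
  do 2!apply: (mulrn_eq0 (natf2_neq0 char2)).
  transitivity (cube c ** x - jac c (c ** c) x + c ** jac c c x
      + jac c c (c ** x)).
    by rewrite /jac /cube; nalg [:: c; x].
  by rewrite cube0 !jac_eq0 namul0l namul0r subr0 !addr0.
exists 3 => w z wE wN; have [w0|w0] := boolP (0 \in w).
  by case/splitPr: w0 => u v; rewrite lmuls_cat /= namul0l lmuls0.
have wc y : y \in w -> y = c.
  move=> yw; have := wE y yw; rewrite inE => /predU1P[//|].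
  case/mapP=> _ /mapP[_ /mapP[x _ ->] ->] yE.
  by move: yw w0; rewrite yE c3 => ->.
case: w wc {wE w0} wN => [|u [|v [|t w]]] // wc _.
have [uc vc tc] : [/\ u = c, v = c & t = c].
  by split; apply: wc; rewrite !inE eqxx ?orbT.
by rewrite uc vc tc /= c3.
Qed.

End CubeZero.

(** * From words of multiplications to nilpotency of subalgebras *)

Section Subalgebras.
Variables (K : fieldType) (A : commNAAlgType K).
Implicit Types (S X : set A) (x y z : A).

Lemma subalgebra_genP (P : set A) X x :
  is_subalgebra P -> (forall y, X y -> P y) -> subalgebra_gen X x -> P x.
Proof. by move=> sP XP; apply; split. Qed.

Lemma subalgebra_gen_sub X x : X x -> subalgebra_gen X x.
Proof. by move=> Xx S [_]; apply. Qed.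

Lemma subalgebra_gen_subalgebra X : is_subalgebra (subalgebra_gen X).
Proof.
split; first split=> [S [[[]]]//|a x y Sx Sy S [sS XS]].
  by case: (sS) => -[_ SL] _; apply: SL; [apply: Sx | apply: Sy].
by move=> x y Sx Sy S [sS XS]; case: (sS) => _; apply; [apply: Sx | apply: Sy].
Qed.

Lemma peval_subalgebra S (t : paren A) : is_subalgebra S ->
  (forall x, x \in leaves t -> S x) -> S (peval t).
Proof.
move=> [_ SM]; elim: t => [x|u IHu v IHv] tS /=.
  by apply: tS; rewrite inE.
by apply: SM; [apply: IHu | apply: IHv] => x xu; apply: tS;
   rewrite mem_cat xu ?orbT.
Qed.

(** Of the two factors of a product of degree at least [2 ^ N.+1], one has degree at least [2 ^ N].
    The descent continues there, and the other factor becomes a letter. *)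
Lemma peval_lmuls S (t : paren A) N : is_subalgebra S ->
  (forall x, x \in leaves t -> S x) -> (2 ^ N <= pdeg t)%N ->
  exists w z,
    [/\ forall x, x \in w -> S x, S z, size w = N & peval t = lmuls w z].
Proof.
move=> sS; elim: N t => [|N IH] t tS tN.
  by exists [::], (peval t); split=> //; apply: peval_subalgebra.
case: t tS tN => [x|u v] /= tS.
  by rewrite leqNgt -[pdeg _](exp1n N.+1) ltn_exp2r.
rewrite /pdeg size_cat => tN.
have split_prod (t s : paren A) :
    (forall x, x \in leaves t -> S x) -> (forall x, x \in leaves s -> S x) ->
    (2 ^ N <= pdeg t)%N ->
    exists w z, [/\ forall x, x \in w -> S x, S z, size w = N.+1 &
                    peval s ** peval t = lmuls w z].
  move=> tS' sS' /(IH _ tS')[w [z [wS Sz wN ->]]].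
  exists (peval s :: w), z; split=> //=; last by rewrite wN.
  by move=> x; rewrite inE => /predU1P[->|/wS//]; apply: peval_subalgebra.
have uS x : x \in leaves u -> S x by move=> xu; apply: tS; rewrite mem_cat xu.
have vS x : x \in leaves v -> S x.
  by move=> xv; apply: tS; rewrite mem_cat xv orbT.
have [uN|uN] := leqP (2 ^ N) (pdeg u).
  by rewrite namulC; apply: split_prod.
apply: split_prod => //; rewrite leqNgt; apply/negP => vN.
by move: tN; rewrite leqNgt expnS mul2n -addnn => /negP; apply;
   rewrite -addSn leq_add // ltnW.
Qed.

Lemma nil_index_le_lmuls S N : is_subalgebra S ->
  (forall w z, (forall x, x \in w -> S x) -> S z -> size w = N ->
    lmuls w z = 0) ->
  nil_index_le S (2 ^ N).
Proof.
move=> sS S0 t tS tN.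
by have [w [z [wS Sz wN ->]]] := peval_lmuls sS tS tN; apply: S0.
Qed.

(** [mult_nilpotent_jj] treats words in the generators only. The elements whose multiplication adds
    at least one to the degree measured by [Z] form a subalgebra, because [namul_jj] turns a product
    into two successive multiplications. *)
Lemma jj_fg_nilpotent (char2 : 2%N \notin [pchar K])
    (cube0 : forall x : A, cube x = 0) k (g : 'I_k -> A) :
  nilpotent (subalgebra_gen (range g)).
Proof.
set E := [seq g i | i <- enum 'I_k].
have [N EN] := mult_nilpotent_jj char2 cube0 E.
exists (2 ^ N)%N.
apply: nil_index_le_lmuls; first exact: subalgebra_gen_subalgebra.
pose Z n r := forall v, {subset v <= E} -> (N <= size v + n)%N -> lmuls v r = 0.
have Zlin n (a : K) x y : Z n x -> Z n y -> Z n (a *: x + y).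
  by move=> Zx Zy v vE vN; rewrite lmulsD lmulsZ Zx ?Zy ?scaler0 ?addr0.
pose P := [set y : A | forall n r, Z n r -> Z n.+1 (y ** r)].
have ZP y : subalgebra_gen (range g) y -> P y.
  apply: subalgebra_genP => [|_ [i _ <-]] /=; last first.
    move=> n r Zr v vE vN; have := Zr (rcons v (g i)); rewrite -cats1 lmuls_cat.
    apply; last by rewrite size_cat addn1 addSnnS.
    move=> t; rewrite mem_cat inE => /orP[/vE//|/eqP->].
    by apply: map_f; rewrite mem_enum.
  split=> [|x u Px Py n r Zr] /=.
    split=> [n r _ v _ _|a x u Px Py n r Zr] /=.
      by rewrite namul0l lmuls0.
    by rewrite namulDl namulZl; apply: Zlin; [apply: Px | apply: Py].
  rewrite namul_jj // -!scaleN1r => v vE vN; rewrite lmulsD !lmulsZ.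
  have vN2 : (N <= size v + n.+2)%N by rewrite addnS leqW.
  by rewrite (Px _ _ (Py _ _ Zr)) ?(Py _ _ (Px _ _ Zr)) ?scaler0 ?addr0.
move=> w z wS _ wN.
suff Zw : Z (size w) (lmuls w z) by apply: (Zw [::]); rewrite // wN.
elim: w wS {wN} => [|y w IH] wS /=.
  by move=> v vE vN; apply: EN => //; rewrite addn0 in vN.
apply: ZP; first by apply: wS; rewrite mem_head.
by apply: IH => x xw; apply: wS; rewrite inE xw orbT.
Qed.

Lemma nilpotent_nil_index S : nilpotent S -> exists n, nil_index S n.
Proof.
move=> [N SN].
have ex : exists n, `[< nil_index_le S n >] by exists N; apply/asboolP.
case: (ex_minnP ex) => n /asboolP Sn nmin; exists n; split=> // m Sm.
by apply: nmin; apply/asboolP.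
Qed.

End Subalgebras.

(** * Evaluation of free algebras *)

Lemma malgUZ (R : fieldType) (T : choiceType) (a : R) (u : T) :
  a *: << (1 : R) *g u >> = << a *g u >> :> {malg R[T]}.
Proof. by apply/malgP => v; rewrite mcoeffZ !mcoeffU mulrnAr mulr1. Qed.

Section Evaluation.
Variables (K : fieldType) (A : commNAAlgType K) (k : nat) (g : 'I_k -> A).
Implicit Types (u v : cmonom 'I_k) (f h : freeComm K k).

Definition mon_eval u : A := peval (paren_map g (repr u)).

Lemma mon_eval_pi t : mon_eval (\pi_(cmonom 'I_k) t) = peval (paren_map g t).
Proof. by apply: peval_ceq; rewrite -eqmodE reprK. Qed.

Lemma mon_evalM u v : mon_eval (cmul u v) = mon_eval u ** mon_eval v.
Proof. by rewrite mon_eval_pi. Qed.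

Definition free_eval f : A := \sum_(u <- msupp f) f@_u *: mon_eval u.

Lemma free_evalEw f (D : {fset cmonom 'I_k}) : (msupp f `<=` D)%fset ->
  free_eval f = \sum_(u <- D) f@_u *: mon_eval u.
Proof.
move=> fD; rewrite /free_eval (big_fset_incl _ fD) //= => u _ uf.
by rewrite mcoeff_outdom ?scale0r.
Qed.

Lemma free_eval_linear (a : K) f h :
  free_eval (a *: f + h) = a *: free_eval f + free_eval h.
Proof.
pose D := (msupp f `|` msupp h)%fset.
have sD : (msupp (a *: f + h) `<=` D)%fset.
  exact: fsubset_trans (msuppD_le _ _) (fsetSU _ (msuppZ_le _ _)).
rewrite (free_evalEw sD) (@free_evalEw f D) ?fsubsetUl //.
rewrite (@free_evalEw h D) ?fsubsetUr // scaler_sumr -big_split /=.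
by apply: eq_bigr => u _; rewrite mcoeffD mcoeffZ scalerDl scalerA.
Qed.

Lemma free_eval0 : free_eval 0 = 0.
Proof. by rewrite /free_eval msupp0 big_seq_fset0. Qed.

Lemma free_eval_sum (I : Type) (r : seq I) (F : I -> freeComm K k) :
  free_eval (\sum_(i <- r) F i) = \sum_(i <- r) free_eval (F i).
Proof.
elim: r => [|i r IH]; first by rewrite !big_nil free_eval0.
by rewrite !big_cons -[F i]scale1r free_eval_linear IH !scale1r.
Qed.

Lemma free_evalU (a : K) u : free_eval << a *g u >> = a *: mon_eval u.
Proof. by rewrite (free_evalEw (@msuppU_le _ _ u a)) big_seq_fset1 mcoeffUU. Qed.

Lemma free_evalM f h : free_eval (f ** h) = free_eval f ** free_eval h.
Proof.
rewrite [f ** h]/(freeComm_mul f h) /freeComm_mul free_eval_sum namul_suml.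
apply: eq_bigr => u _; rewrite free_eval_sum namul_sumr.
apply: eq_bigr => v _; rewrite free_evalU mon_evalM namulZl namulZr scalerA.
by [].
Qed.

Lemma free_eval_var i : free_eval << cvar i >> = g i.
Proof. by rewrite free_evalU scale1r mon_eval_pi. Qed.

Lemma free_eval_peval t :
  free_eval (peval t) = peval (paren_map free_eval t).
Proof. by elim: t => //= s IHs t IHt; rewrite free_evalM IHs IHt. Qed.

Lemma free_eval_onto x : subalgebra_gen (range g) x -> exists f, x = free_eval f.
Proof.
apply: (subalgebra_genP (P := [set x | exists f, x = free_eval f])).
  split=> [|y z [f ->] [h ->]] /=; last by exists (f ** h); rewrite free_evalM.
  split=> [|a y z [f ->] [h ->]] /=; first by exists 0; rewrite free_eval0.
  by exists (a *: f + h); rewrite free_eval_linear.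
by move=> _ [i _ <-]; exists << cvar i >>; rewrite /= free_eval_var.
Qed.

Lemma free_eval_onto_paren (t : paren A) :
  (forall x, x \in leaves t -> subalgebra_gen (range g) x) ->
  exists t', t = paren_map free_eval t'.
Proof.
elim: t => [x|s IHs t IHt] tS.
  have [|f ->] := @free_eval_onto x; first by apply: tS; rewrite /= mem_head.
  by exists (PLeaf f).
have [x xs|s' ->] := IHs; first by apply: tS; rewrite mem_cat xs.
have [x xt|t' ->] := IHt; first by apply: tS; rewrite mem_cat xt orbT.
by exists (PNode s' t').
Qed.

Lemma free_eval_ideal (P : set A) : is_ideal P -> is_ideal (free_eval @^-1` P).
Proof.
move=> [[P0 PL] PM]; split=> [|f h] /=; last by rewrite free_evalM; apply: PM.
by split=> [|a f h] /=; rewrite ?free_eval0 // free_eval_linear; apply: PL.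
Qed.

End Evaluation.

(** * The quotient map as a homomorphism *)

Section QuotientMap.
Variables (K : fieldType) (A : commNAAlgType K) (X : set A).
Notation quo := (\pi_(quotAlg X)).
Implicit Types x y : A.

Lemma quotAlg_piM x y : quo (x ** y) = quo x ** quo y.
Proof. exact: esym (quotAlg_mul_pi _ x y). Qed.

Lemma quotAlg_piZ (a : K) x : quo (a *: x) = a *: quo x.
Proof. exact: esym (quotAlg_scale_pi _ a x). Qed.

Lemma quotAlg_pi_linear (a : K) x y : quo (a *: x + y) = a *: quo x + quo y.
Proof. by rewrite quotAlg_piD quotAlg_piZ. Qed.

Lemma quotAlg_pi0 : quo 0 = 0.
Proof. by rewrite -(scale0r 0) quotAlg_piZ scale0r. Qed.

Lemma quotAlg_pi_eq0 x : quo x = 0 <-> ideal_gen X x.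
Proof. by rewrite -quotAlg_pi0 quotAlg_eqP subr0. Qed.

Lemma quotAlg_pi_peval t : quo (peval t) = peval (paren_map quo t).
Proof. by elim: t => //= s IHs t IHt; rewrite quotAlg_piM IHs IHt. Qed.

Lemma quotAlg_cube (x : quotAlg X) : range (@cube K A) `<=` X -> cube x = 0.
Proof.
move=> cX; rewrite -[x]quotAlg_piK /cube -!quotAlg_piM.
by apply/quotAlg_pi_eq0 => S [_]; apply; apply: cX; exists (repr x).
Qed.

Lemma quotAlg_gen (I : Type) (g : I -> A) :
  subalgebra_gen (range g) = [set: A] ->
  subalgebra_gen (range (fun i => quo (g i))) = [set: quotAlg X].
Proof.
move=> gA; apply/seteqP; split=> // x _; rewrite -[x]quotAlg_piK.
have [[S0 SL] SM] := subalgebra_gen_subalgebra (range (fun i => quo (g i))).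
have : subalgebra_gen (range g) (repr x) by rewrite gA.
apply: (subalgebra_genP
  (P := [set y | subalgebra_gen (range (fun i => quo (g i))) (quo y)])).
  split=> [|y z] /=; last by rewrite quotAlg_piM; apply: SM.
  split=> [|a y z] /=; first by rewrite quotAlg_pi0.
  by rewrite quotAlg_pi_linear; apply: SL.
by move=> _ [i _ <-] /=; apply: subalgebra_gen_sub; exists i.
Qed.

End QuotientMap.

(** * The free algebra with vanishing cubes *)

Section FreeCubeZero.
Variables (K : fieldType) (k : nat).

Lemma freeComm_mulU (u v : cmonom 'I_k) :
  (<< u >> : freeComm K k) ** << v >> = << cmul u v >>.
Proof.
rewrite [LHS](@freeComm_mulEw _ _ _ _ [fset u]%fset [fset v]%fset) ?msuppU_le //.
by rewrite !big_seq_fset1 !mcoeffUU mulr1.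
Qed.

Lemma freeComm_gen :
  subalgebra_gen (range (fun i : 'I_k => << cvar i >> : freeComm K k)) =
  [set: freeComm K k].
Proof.
apply/seteqP; split=> // f _; set S := subalgebra_gen _.
have [[S0 SL] SM] : is_subalgebra S by apply: subalgebra_gen_subalgebra.
have SU (t : paren 'I_k) : S << \pi_(cmonom 'I_k) t >>.
  elim: t => [i|s IHs t IHt]; first by apply: subalgebra_gen_sub; exists i.
  by have := SM _ _ IHs IHt; rewrite freeComm_mulU cmul_pi.
rewrite (monalgE f); elim: (enum_fset (msupp f)) => [|u r IH].
  by rewrite big_nil.
rewrite big_cons.
rewrite -malgUZ; apply: SL IH; rewrite -[u]reprK; exact: SU.
Qed.

Lemma freeCube0_nil_index (char2 : 2%N \notin [pchar K]) :
  exists n, nil_index [set: freeCube0 K k] n.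
Proof.
apply: nilpotent_nil_index.
rewrite -[X in nilpotent X](quotAlg_gen _ freeComm_gen).
by apply: jj_fg_nilpotent => // x; apply: quotAlg_cube.
Qed.

(** A long product vanishes in the quotient, so it lies in the ideal generated by the cubes, and [I]
    contains that ideal. *)
Lemma freeCube0_nil_index_le n (I : set (freeComm K k)) t :
  nil_index_le [set: freeCube0 K k] n -> is_ideal I ->
  (forall f, I (cube f)) -> (n <= pdeg t)%N -> I (peval t).
Proof.
move=> nilF idI cI tn.
have : \pi_(quotAlg (range (@cube K (freeComm K k)))) (peval t) = 0.
  by rewrite quotAlg_pi_peval; apply: nilF; rewrite ?pdeg_paren_map.
by move/quotAlg_pi_eq0; apply; split=> // _ [f _ <-].
Qed.

End FreeCubeZero.

(** * Nilpotency of words acting on the cubes *)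

Section RepeatedLetters.
Variables (T : eqType) (M : zmodType) (Phi : seq T -> M) (w0 : seq T).
Hypotheses (M2 : forall m : M, m *+ 2 = 0 -> m = 0)
  (M3 : forall m : M, m *+ 3 = 0 -> m = 0).
Hypothesis central : forall p s x y z, perm_eq (p ++ [:: x, y, z & s]) w0 ->
  Phi (p ++ [:: x, y, z & s]) + Phi (p ++ [:: y, x, z & s]) =
  Phi (p ++ [:: z, x, y & s]) + Phi (p ++ [:: z, y, x & s]).
Hypothesis cubic : forall p s x y z, perm_eq (p ++ [:: x, y, z & s]) w0 ->
  Phi (p ++ [:: x, y, z & s]) + Phi (p ++ [:: x, z, y & s])
  + Phi (p ++ [:: y, x, z & s]) + Phi (p ++ [:: y, z, x & s])
  + Phi (p ++ [:: z, x, y & s]) + Phi (p ++ [:: z, y, x & s]) = 0.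

(* [Phi] of the anticommutator of [x] and [y] placed anywhere inside [w]. *)
Let B x y w := Phi [:: x, y & w] + Phi [:: y, x & w].

Let perm_count (v w : seq T) : (forall P, count P v = count P w) ->
  perm_eq w w0 -> perm_eq v w0.
Proof. by move=> e; apply: perm_trans; apply/permP. Qed.

(** [central] carries the anticommutator to the front, across one letter of the prefix at a time. *)
Let BE p s x y : perm_eq (p ++ [:: x, y & s]) w0 ->
  Phi (p ++ [:: x, y & s]) + Phi (p ++ [:: y, x & s]) = B x y (p ++ s).
Proof.
elim/last_ind: p s => [//|p z IH] s; rewrite !cat_rcons => pw.
have pw' : perm_eq (p ++ [:: x, y, z & s]) w0.
  by apply: perm_count pw => P; rewrite !count_cat /=; lia.
by rewrite -central // IH.
Qed.

(** The six words of [cubic] pair off into three anticommutators. *)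
Let Bcubic p s x y z : perm_eq (p ++ [:: x, y, z & s]) w0 ->
  B x y (p ++ z :: s) + B y z (p ++ x :: s) + B z x (p ++ y :: s) = 0.
Proof.
move=> pw; rewrite -!BE; first last; try by
  apply: perm_count pw => P; rewrite !count_cat /=; lia.
rewrite -[RHS](cubic pw) -!addrA; congr (_ + _).
rewrite [RHS]addrCA; congr (_ + _).
rewrite [RHS]addrCA; congr (_ + _).
by rewrite [RHS]addrC -!addrA addrCA.
Qed.

(** [Bcubic] with three letters [u] reads [3 B u u w = 0]. *)
Let B0 u w : perm_eq [:: u, u & w] w0 -> u \in w -> B u u w = 0.
Proof.
move=> pw uw; case/splitPr: uw pw => p s pw; apply: M3.
rewrite mulrS mulr2n addrA; apply: Bcubic.
by apply: perm_count pw => P; rewrite /= !count_cat /=; lia.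
Qed.

(** In [Bcubic] with letters [u], [u], [x] the first summand vanishes by [B0], and the other two
    agree. *)
Let B1 u x w : perm_eq [:: u, x & w] w0 -> (1 < count_mem u w)%N -> B u x w = 0.
Proof.
move=> pw uw; have : u \in w by rewrite -has_pred1 has_count ltnW.
move=> uw'; case/splitPr: uw' pw uw => p s pw uw; apply: M2.
have ups : u \in p ++ x :: s.
  rewrite -has_pred1 has_count; move: uw; rewrite !count_cat /= eqxx; lia.
have pw' : perm_eq (p ++ [:: u, u, x & s]) w0.
  by apply: perm_count pw => P; rewrite /= !count_cat /=; lia.
have := Bcubic pw'; rewrite B0 ?add0r; first last => //.
  by apply: perm_count pw => P; rewrite /= !count_cat /=; lia.
by rewrite mulr2n {2}/B [X in B _ _ _ + X]addrC.
Qed.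

(** By [B1], transposing [u] with a neighbour changes the sign of [Phi], so two occurrences of [u]
    can be brought together; then [2 Phi] is a value of [B u u], zero by [B0]. The third occurrence
    supplies the side conditions of [B0] and [B1]. *)
Lemma repeated_letter_vanish u : (2 < count_mem u w0)%N -> Phi w0 = 0.
Proof.
have adj q p s : perm_eq (p ++ u :: q ++ u :: s) w0 ->
    (2 < count_mem u (p ++ u :: q ++ u :: s))%N ->
    Phi (p ++ u :: q ++ u :: s) = 0.
  elim: q p => [|x q IH] p pw cu.
    apply: M2; rewrite mulr2n BE // B0 //.
      by apply: perm_count pw => P; rewrite /= !count_cat /=; lia.
    by rewrite -has_pred1 has_count; move: cu; rewrite !count_cat /= eqxx; lia.
  rewrite cat_cons in pw cu *; have [xu|xu] := eqVneq x u.
    rewrite xu in pw *; apply: M2; rewrite mulr2n BE // B0 //.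
      apply: perm_count pw => P.
      by rewrite /= ?count_cat /= ?count_cat /= ?count_cat /=; lia.
    by rewrite !mem_cat mem_head !orbT.
  move: cu; rewrite !count_cat /= !count_cat /= (negPf xu) eqxx => cu.
  have := BE pw; rewrite B1; first last.
  - by rewrite !count_cat /= ?count_cat /= ?eqxx; lia.
  - apply: perm_count pw => P.
    by rewrite /= ?count_cat /= ?count_cat /= ?count_cat /=; lia.
  rewrite -[X in _ + Phi X]cat_rcons [X in _ + X]IH ?addr0 //.
    apply: perm_count pw => P; rewrite cat_rcons ?count_cat /= ?count_cat /=.
    by rewrite ?count_cat /=; lia.
  rewrite cat_rcons !count_cat /= ?count_cat /= ?count_cat /= (negPf xu) ?eqxx.
  lia.
have split_mem w : u \in w -> exists p s, w = p ++ u :: s.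
  by move=> uw; case/splitPr: uw => p s; exists p, s.
move=> cu; have /split_mem[p [s w0E]] : u \in w0.
  by rewrite -has_pred1 has_count; lia.
have : (u \in s) || (u \in p).
  by rewrite -!has_pred1 !has_count; move: cu; rewrite w0E count_cat /= eqxx; lia.
case/orP=> /split_mem[q [r E]].
  by rewrite w0E E; apply: adj; rewrite -E -w0E.
by rewrite w0E E -catA; apply: adj; rewrite -cat_cons catA -E -w0E.
Qed.
End RepeatedLetters.

Lemma size_le_count (T : eqType) (m : nat) (F w : seq T) :
  {subset w <= F} -> (forall u, (count_mem u w <= m)%N) ->
  (size w <= m * size F)%N.
Proof.
elim: F w => [|u F IH] w wF wm.
  by case: w wF {wm} => // v w /(_ v (mem_head _ _)).
rewrite -(count_predC (pred1 u)) mulnS leq_add // -size_filter.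
apply: IH => [v|v].
  by rewrite mem_filter /= => /andP[vu /wF]; rewrite inE (negPf vu).
by rewrite count_filter; apply: leq_trans (wm v); apply: sub_count => x /andP[].
Qed.

(** * The explicit bound for a finitely generated subalgebra *)

Section MainBound.
Variables (K : fieldType) (A : commNAAlgType K) (k n : nat) (g : 'I_k -> A).
Hypotheses (char2 : 2%N \notin [pchar K]) (char3 : 3%N \notin [pchar K]).
Hypotheses (L3 : L3_identity A) (nilF : nil_index_le [set: freeCube0 K k] n).

Notation S := (subalgebra_gen (range g)).
Notation C := (@cube_span K A).
Notation ev := (mon_eval g).
Notation D := (2 * n.-1 * dim_cmonom n k).+1.

Let idC : is_ideal C.
Proof.
split; first exact: cube_span_subspace.
by move=> x y; apply: cube_span_mull.
Qed.

(** The preimage of [C] under evaluation is an ideal of the free algebra containing all cubes. *)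
Lemma cube_span_peval (t : paren A) :
  (forall x, x \in leaves t -> S x) -> (n <= pdeg t)%N -> C (peval t).
Proof.
move=> /free_eval_onto_paren[t' ->]; rewrite pdeg_paren_map => tn.
rewrite -free_eval_peval.
apply: (freeCube0_nil_index_le (I := free_eval g @^-1` C) nilF) tn.
  exact: free_eval_ideal.
by move=> f /=; rewrite /cube !free_evalM; apply: cube_span_cube.
Qed.

Lemma cube_span_mon_eval u : (n <= cdeg u)%N -> C (ev u).
Proof.
move=> un; apply: cube_span_peval; last by rewrite pdeg_paren_map.
move=> x; rewrite leaves_paren_map => /mapP[i _ ->].
by apply: subalgebra_gen_sub; exists i.
Qed.

Lemma cube_span_lmuls (w : seq A) c : C c -> C (lmuls w c).
Proof. by move=> Cc; elim: w => //= y w IH; apply: cube_span_mull. Qed.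

Lemma cdegM (u v : cmonom 'I_k) : cdeg (cmul u v) = (cdeg u + cdeg v)%N.
Proof. by rewrite cdeg_pi /pdeg /= size_cat. Qed.

Definition word_deg (w : seq (cmonom 'I_k)) : nat := \sum_(u <- w) cdeg u.

Lemma word_deg_cat v w : word_deg (v ++ w) = (word_deg v + word_deg w)%N.
Proof. exact: big_cat. Qed.

Lemma word_deg_cons u w : word_deg (u :: w) = (cdeg u + word_deg w)%N.
Proof. exact: big_cons. Qed.

(** Pigeonhole: without a threefold letter there are at most [2 * dim_cmonom n k] letters, each of
    degree at most [n.-1], which falls one short of [D]. *)
Lemma exists_repeated_letter w :
  (forall u, u \in w -> (cdeg u < n)%N) -> (D <= word_deg w)%N ->
  exists u, (2 < count_mem u w)%N.
Proof.
move=> wn wD; apply: contrapT => no_rep.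
have w2 u : (count_mem u w <= 2)%N.
  by rewrite leqNgt; apply/negP => u2; apply: no_rep; exists u.
have wF : {subset w <= fset_set (cmonom_lt n k)}.
  move=> u /wn un; rewrite in_fset_set ?inE //; exact: finite_cmonom_lt.
have sw : (size w <= 2 * dim_cmonom n k)%N := size_le_count wF w2.
have sn : (word_deg w <= size w * n.-1)%N.
  rewrite /word_deg -sum1_size big_distrl /= big_seq [leqRHS]big_seq.
  apply: leq_sum => u /wn un; rewrite mul1n; lia.
by move: wD; rewrite ltnNge (leq_trans sn) // mulnAC leq_mul2r sw orbT.
Qed.

(** Induction on the length at fixed degree. A letter of degree at least [n] evaluates into [C] and
    kills [C]; otherwise some letter occurs three times, and the relations of
    [repeated_letter_vanish] hold exactly, their error terms being shorter words of the same
    degree. *)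
Lemma words_vanish_cube_span w c :
  C c -> (D <= word_deg w)%N -> lmuls (map ev w) c = 0.
Proof.
have [r] := ubnP (size w); elim: r w c => // r IH w c /ltnSE wr Cc wD.
have [/hasP[u uw un]|/hasPn w_lt] := boolP (has (fun u => n <= cdeg u)%N w).
  case/splitPr: uw => p s; rewrite map_cat lmuls_cat /=.
  rewrite cube_span_mul0 ?lmuls0 //; first exact: cube_span_mon_eval.
  exact: cube_span_lmuls.
have [u u2] : exists u, (2 < count_mem u w)%N.
  by apply: exists_repeated_letter => // u /w_lt; rewrite ltnNge.
have van v : (size v < size w)%N -> word_deg v = word_deg w ->
    lmuls (map ev v) c = 0.
  by move=> vw vD; apply: IH => //; [exact: leq_trans vw wr | rewrite vD].
(* Here [v] stands for the one or two monomials that replace the letters [x], [y], [z] in an error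
   term. *)
have van3 p s x y z v : perm_eq (p ++ [:: x, y, z & s]) w -> (size v < 3)%N ->
    word_deg v = word_deg [:: x; y; z] ->
    lmuls (map ev p) (lmuls (map ev v) (lmuls (map ev s) c)) = 0.
  move=> pw v3 vD; rewrite -!lmuls_cat -!map_cat; apply: van.
    by rewrite -(perm_size pw) !size_cat /=; lia.
  have <- : word_deg (p ++ [:: x; y; z] ++ s) = word_deg w by exact: perm_big.
  by rewrite !word_deg_cat vD addnA.
pose Phi v := lmuls (map ev v) c.
apply: (@repeated_letter_vanish _ A Phi w _ _ _ _ u) => //; rewrite {}/Phi.
- by move=> m; apply: mulrn_eq0 (natf2_neq0 char2).
- by move=> m; apply: mulrn_eq0 (natf3_neq0 char3).
- move=> p s x y z pw; apply: subr0_eq.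
  rewrite !map_cat !lmuls_cat /= -!lmulsD -lmulsB (l3_central char2 L3).
  rewrite -!mon_evalM !lmulsB.
  rewrite (van3 p s x y z [:: z; cmul x y] pw) ?(van3 p s x y z [:: x; cmul y z] pw)
    ?(van3 p s x y z [:: y; cmul x z] pw) ?(van3 p s x y z [:: cmul x (cmul y z)] pw)
    ?(van3 p s x y z [:: cmul y (cmul x z)] pw) ?subr0 //
    !word_deg_cons ?cdegM;
    move: (cdeg x) (cdeg y) (cdeg z) (word_deg [::]) => *; lia.
- move=> p s x y z pw.
  rewrite !map_cat !lmuls_cat /= -!lmulsD (l3_cubic char2 L3).
  rewrite -!mon_evalM !lmulsD.
  rewrite (van3 p s x y z [:: cmul x (cmul y z)] pw)
    ?(van3 p s x y z [:: cmul y (cmul z x)] pw)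
    ?(van3 p s x y z [:: cmul z (cmul x y)] pw) ?addr0 //
    !word_deg_cons ?cdegM;
    move: (cdeg x) (cdeg y) (cdeg z) (word_deg [::]) => *; lia.
Qed.

Lemma cdeg_gt0 (u : cmonom 'I_k) : (0 < cdeg u)%N.
Proof. exact: pdeg_gt0. Qed.

Lemma lmuls_vanish_cube_span (w : seq A) c :
  (forall x, x \in w -> S x) -> C c -> (D <= size w)%N -> lmuls w c = 0.
Proof.
move=> wS Cc wD.
(* [v] collects the monomials into which the first letters have been expanded; an unexpanded letter
   counts 1, the least degree of a monomial. *)
suff H v : (D <= word_deg v + size w)%N -> lmuls (map ev v) (lmuls w c) = 0.
  by apply: (H [::]); apply: leq_trans wD (leq_addl _ _).
elim: w v wS {wD} => [|y w IH] v wS vD /=.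
  by apply: words_vanish_cube_span; rewrite ?addn0 in vD *.
have [f ->] : exists f, y = free_eval g f.
  by apply: free_eval_onto; apply: wS; rewrite mem_head.
rewrite namul_suml; set z := lmuls w c.
have -> : lmuls (map ev v) (\sum_(u <- msupp f) f@_u *: ev u ** z) =
    \sum_(u <- msupp f) f@_u *: lmuls (map ev (rcons v u)) z.
  elim: (enum_fset (msupp f)) => [|u r IHr]; first by rewrite !big_nil lmuls0.
  by rewrite !big_cons lmulsD IHr namulZl lmulsZ map_rcons -cats1 lmuls_cat.
apply: big1 => u _; rewrite IH ?scaler0 // => [x xw|].
  by apply: wS; rewrite inE xw orbT.
rewrite -cats1 word_deg_cat word_deg_cons -addnA.
apply: leq_trans vD _; rewrite leq_add2l /= -add1n leq_add ?leq_addr //.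
by apply: leq_trans (cdeg_gt0 u) (leq_addr _ _).
Qed.

(** For [n <= 1] no monomial has degree below [n], so the claimed bound is [2 ^ 0] and demands
    [S = 0]. Here all of [S] lies in [C], so its products and cubes vanish, and the zero ideal can
    be used in place of [C]. *)
Lemma subalgebra_gen_eq0 x : (n <= 1)%N -> S x -> x = 0.
Proof.
move=> n1 /free_eval_onto[f ->].
have Cf h : C (free_eval g h).
  apply: (freeCube0_nil_index_le (I := free_eval g @^-1` C) (t := PLeaf h) nilF) n1.
    exact: free_eval_ideal.
  by move=> e /=; rewrite /cube !free_evalM; apply: cube_span_cube.
apply: (freeCube0_nil_index_le (I := free_eval g @^-1` [set 0])
  (t := PLeaf f) nilF) n1.
  apply: free_eval_ideal; split=> [|y z ->]; last by rewrite namul0r.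
  by split=> // a y z -> ->; rewrite scaler0 addr0.
by move=> h /=; rewrite /cube free_evalM cube_span_mul0 // -free_evalM.
Qed.

(** A word of [4 * n * d] letters is cut before its last [n]: these carry the argument into [C], and
    the remaining ones annihilate [C]. *)
Lemma nil_index_le_subalgebra_gen : (1 <= k)%N ->
  nil_index_le S (2 ^ (4 * n * dim_cmonom n k)).
Proof.
move=> k1; apply: nil_index_le_lmuls; first exact: subalgebra_gen_subalgebra.
move=> w z wS Sz wN.
have [n1|n1] := leqP n 1; first by rewrite (subalgebra_gen_eq0 n1 Sz) lmuls0.
have d0 : (0 < dim_cmonom n k)%N.
  rewrite /dim_cmonom cardfs_gt0; apply/fset0Pn.
  exists (cvar (Ordinal k1)); rewrite in_fset_set; last exact: finite_cmonom_lt.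
  by rewrite inE /cmonom_lt /= [cdeg _]cdeg_pi.
set d := dim_cmonom n k in wN d0 *.
(* Since [d >= 1], [4nd - n >= 3nd], which is at least [2(n-1)d + 1]. *)
have w1 : (D <= size (take (size w - n) w))%N.
  rewrite size_take_min wN -/d; nia.
rewrite -(cat_take_drop (size w - n) w) lmuls_cat.
apply: lmuls_vanish_cube_span => // [x /mem_take/wS//|].
set v := drop _ _.
have vS x : x \in v -> S x by move=> /mem_drop/wS.
have nv : (n <= size v)%N by rewrite /v size_drop wN; nia.
pose tree := foldr (fun y t => PNode (PLeaf y) t) (PLeaf z) v.
have <- : peval tree = lmuls v z by rewrite /tree; elim: (v) => //= y r ->.
have tree_leaves : leaves tree = rcons v z.
  by rewrite /tree; elim: (v) => //= y r ->.
apply: cube_span_peval; last by rewrite /pdeg tree_leaves size_rcons ltnW.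
by move=> x; rewrite tree_leaves mem_rcons inE => /predU1P[->//|/vS].
Qed.

End MainBound.

Lemma nil_index_le_subset (K : fieldType) (A : commNAAlgType K) (X Y : set A) N :
  X `<=` Y -> nil_index_le Y N -> nil_index_le X N.
Proof. by move=> XY nilY t tX; apply: nilY => x /tX/XY. Qed.

Theorem theorem7 (K : fieldType)
    (char2 : 2%N \notin [pchar K]) (char3 : 3%N \notin [pchar K]) :
  (forall A : commNAAlgType K, L3_identity A -> locally_nilpotent A)
  /\
  (forall k : nat, (1 <= k)%N ->
     exists n : nat,
       nil_index [set: freeCube0 K k] n /\
       forall A : commNAAlgType K, generated_by A k -> L3_identity A ->
         nil_index_le [set: A] (2 ^ (4 * n * dim_cmonom n k))%N).
Proof.
split=> [A L3 X /finite_seqP[s ->]|k k1].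
  (* The extra index yields the default 0, so that there is a generator even when [s] is empty. *)
  pose g (i : 'I_(size s).+1) := nth 0 s i.
  have [n [nilF _]] := freeCube0_nil_index (size s).+1 char2.
  exists (2 ^ (4 * n * dim_cmonom n (size s).+1))%N.
  have := nil_index_le_subalgebra_gen (g := g) char2 char3 L3 nilF (ltn0Sn _).
  apply: nil_index_le_subset.
  move=> x; apply: subalgebra_genP; first exact: subalgebra_gen_subalgebra.
  move=> y /= ys; apply: subalgebra_gen_sub.
  have ys' : (index y s < (size s).+1)%N by rewrite ltnS index_size.
  by exists (Ordinal ys'); rewrite // /g nth_index.
have [n [nilF nmin]] := freeCube0_nil_index k char2.
exists n; split=> // A [g gA] L3; rewrite -gA.
exact: nil_index_le_subalgebra_gen.
Qed.
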